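(* Let $m$ be a positive integer, let $\Delta=\{1,\dots,m\}$, let $\Gamma$ be a set, and let $\gamma,\nu$ be distinct elements of $\Gamma$. Let $W=\mathrm{Sym}(\Gamma)\wr\mathrm{Sym}(\Delta)$ act in product action on $\Gamma^m$. Suppose that $C\subset\Gamma^m$ is a code with $|C|>1$, with minimum distance $d$, and with automorphism group $X\leq W$, such that $X$ induces a transitive group $H$ on $\Delta$ and some component $G$ of $X$ is $2$-transitive on $\Gamma$. Then there exists $x\in W$ such that the equivalent code $C^x$ has automorphism group $X^x=x^{-1}Xx\leq G\wr K$ for some subgroup $K$ of $\mathrm{Sym}(\Delta)$ conjugate to $H$ in $\mathrm{Sym}(\Delta)$, and $C^x$ contains the $m$-tuples $(\gamma^m)=(\gamma,\dots,\gamma)$ and $(\nu^d,\gamma^{m-d})$, where the latter has its first $d$ entries equal to $\nu$ and its remaining $m-d$ entries equal to $\gamma$.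
   Context: All actions are on the right: the image of $\delta$ under a map $f$ is written $\delta f$, and products are composed left to right. Wreath product. Let $\Delta=\{1,\dots,m\}$. For $G\leq\mathrm{Sym}(\Gamma)$ and $H\leq\mathrm{Sym}(\Delta)$, the group $G\wr H$ is the semidirect product $G^m\rtimes H$, where $h\in H$ acts on $G^m$, viewed as the functions $f:\Delta\to G$, $i\mapsto if$, by $i f^{h}=(ih^{-1})f$. Elements are written uniquely as $fh$ with $f=(g_1,\dots,g_m)\in G^m$ and $h\in H$, where $if=g_i$, and $h^{-1}fh=f^h$. The full wreath product $W=\mathrm{Sym}(\Gamma)\wr\mathrm{Sym}(\Delta)$ has base group $B=(\mathrm{Sym}(\Gamma))^m$, and $G\wr H$ is regarded as the particular subgroup $\{fh : f\in G^m,\ h\in H\}$ of $W$. Product action. $W$ acts on $\Gamma^m$ by $(\gamma_1,\dots,\gamma_m)\big((g_1,\dots,g_m)h\big)=(\gamma_{1h^{-1}}g_{1h^{-1}},\dots,\gamma_{mh^{-1}}g_{mh^{-1}})$. Induced action and components. Let $X\leq W$. The induced action of $X$ on $\Delta$ is $fh:\delta\mapsto\delta h$; the group induced by $X$ on $\Delta$ is $\{h : fh\in X\text{ for some }f\in B\}\leq\mathrm{Sym}(\Delta)$. For $\delta\in\Delta$, the $\delta$-component of $X$ is the subgroup $\{\delta f : fh\in X,\ f\in B,\ h\in\mathrm{Sym}(\Delta),\ \delta h=\delta\}$ of $\mathrm{Sym}(\Gamma)$. A component of $X$ is a $\delta$-component for some $\delta\in\Delta$. Codes. A code is a subset $C$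 of $\Gamma^m$. Its automorphism group is the setwise stabiliser of $C$ in $W$. For $x\in W$, $C^x=\{cx : c\in C\}$, and such an image is called a code equivalent to $C$. The minimum distance of $C$ (with $|C|>1$) is the minimum number of entries in which two distinct elements of $C$ differ. *)

(* Defs.v *)
From HB Require Import structures.
From mathcomp Require Import all_boot all_fingroup.
From mathcomp Require Import mathcomp_extra boolp classical_sets.

Set Implicit Arguments.
Unset Strict Implicit.
Unset Printing Implicit Defensive.

Local Open Scope group_scope.
Local Open Scope classical_set_scope.

(* Sym(T) for an arbitrary, possibly infinite, type T.  The inverse function is
   a field, but two elements with the same underlying function are equal
   (sym_ext).  The product is s * t = "s, then t", as for MathComp's 'S_n. *)
Record sym (T : Type) := Sym {
  sym_fun :> T -> T;
  sym_inv : T -> T;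
  sym_funK : cancel sym_fun sym_inv;
  sym_invK : cancel sym_inv sym_fun
}.

Lemma sym_ext (T : Type) (s t : sym T) : s =1 t -> s = t.
Proof.
case: s t => [f f' fK f'K] [g g' gK g'K] /= /funext efg.
rewrite -{}efg in gK g'K *.
have efg' : f' = g' by apply/funext => x; rewrite -[in LHS](g'K x) fK.
rewrite -{}efg' in gK g'K *.
by congr Sym; apply: Prop_irrelevance.
Qed.

HB.instance Definition _ (T : Type) := gen_eqMixin (sym T).
HB.instance Definition _ (T : Type) := gen_choiceMixin (sym T).

Section SymGroup.
Variable T : Type.

Definition sym_one : sym T := @Sym T id id (frefl _) (frefl _).
Definition sym_mul (s t : sym T) : sym T :=
  Sym (can_comp (@sym_funK T t) (@sym_funK T s))
      (can_comp (@sym_invK T s) (@sym_invK T t)).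
Definition sym_opp (s : sym T) : sym T := Sym (@sym_invK T s) (@sym_funK T s).

Fact sym_mulA : associative sym_mul. Proof. by move=> *; apply: sym_ext. Qed.
Fact sym_mul1 : left_id sym_one sym_mul. Proof. by move=> *; apply: sym_ext. Qed.
Fact sym_1mul : right_id sym_one sym_mul. Proof. by move=> *; apply: sym_ext. Qed.
Fact sym_mulV : left_inverse sym_one sym_opp sym_mul.
Proof. by move=> s; apply: sym_ext => x /=; rewrite sym_invK. Qed.
Fact sym_Vmul : right_inverse sym_one sym_opp sym_mul.
Proof. by move=> s; apply: sym_ext => x /=; rewrite sym_funK. Qed.

HB.instance Definition _ :=
  isGroup.Build (sym T) sym_mulA sym_mul1 sym_1mul sym_mulV sym_Vmul.

Lemma symM (s t : sym T) x : (s * t) x = t (s x). Proof. by []. Qed.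
Lemma sym1 x : (1 : sym T) x = x. Proof. by []. Qed.

Definition two_transitive (G : set (sym T)) : Prop :=
  forall a b c e : T, a <> b -> c <> e ->
    exists2 g : sym T, G g & g a = c /\ g b = e.

End SymGroup.

(* Wreath f h is the element f h of W = Sym(T) wr Sym(m), with Delta = 'I_m. *)
Record wreath (T : Type) (m : nat) := Wreath {
  wbase : {ffun 'I_m -> sym T};
  wtop : 'S_m
}.

HB.instance Definition _ (T : Type) m := gen_eqMixin (wreath T m).
HB.instance Definition _ (T : Type) m := gen_choiceMixin (wreath T m).

Section WreathProduct.
Variables (T : Type) (m : nat).
Implicit Types (f : {ffun 'I_m -> sym T}) (h : 'S_m) (w : wreath T m).

(* f^h *)
Definition base_act f h : {ffun 'I_m -> sym T} := [ffun i => f (h^-1 i)].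

Definition wreath_one : wreath T m := Wreath 1 1.
(* (f h)(f' h') = f (h f' h^-1) h h' *)
Definition wreath_mul w w' : wreath T m :=
  Wreath (wbase w * base_act (wbase w') (wtop w)^-1) (wtop w * wtop w').
Definition wreath_inv w : wreath T m :=
  Wreath (base_act (wbase w)^-1 (wtop w)) (wtop w)^-1.

Lemma ffunMgE f f' i : (f * f') i = f i * f' i. Proof. exact: ffunE. Qed.
Lemma ffun1gE i : (1 : {ffun 'I_m -> sym T}) i = 1. Proof. exact: ffunE. Qed.
Lemma ffunVgE f i : f^-1 i = (f i)^-1. Proof. exact: ffunE. Qed.
Let ffE := (ffunMgE, ffun1gE, ffunVgE, ffunE).

Fact wreath_mulA : associative wreath_mul.
Proof.
move=> [f h] [f' h'] [f'' h'']; congr Wreath => /=; last by rewrite mulgA.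
by apply/ffunP => i; rewrite !ffE /= mulgA !invgK permM.
Qed.
Fact wreath_mul1 : left_id wreath_one wreath_mul.
Proof.
move=> [f h]; congr Wreath => /=; last by rewrite mul1g.
by apply/ffunP => i; rewrite !ffE /= mul1g !invgK perm1.
Qed.
Fact wreath_1mul : right_id wreath_one wreath_mul.
Proof.
move=> [f h]; congr Wreath => /=; last by rewrite mulg1.
by apply/ffunP => i; rewrite !ffE /= mulg1.
Qed.
Fact wreath_mulV : left_inverse wreath_one wreath_inv wreath_mul.
Proof.
move=> [f h]; congr Wreath => /=; last by rewrite mulVg.
by apply/ffunP => i; rewrite !ffE /= !invgK mulVg.
Qed.
Fact wreath_Vmul : right_inverse wreath_one wreath_inv wreath_mul.
Proof.
move=> [f h]; congr Wreath => /=; last by rewrite mulgV.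
by apply/ffunP => i; rewrite !ffE /= !invgK permK mulgV.
Qed.

HB.instance Definition _ := isGroup.Build (wreath T m)
  wreath_mulA wreath_mul1 wreath_1mul wreath_mulV wreath_Vmul.

Lemma wreathE w : w = Wreath (wbase w) 1 * Wreath 1 (wtop w).
Proof.
case: w => f h; congr Wreath => /=; last by rewrite mul1g.
by apply/ffunP => i; rewrite !ffE /= mulg1.
Qed.

Lemma wreath_conj f h : Wreath f 1 ^ Wreath 1 h = Wreath (base_act f h) 1.
Proof.
congr Wreath => /=; last by rewrite mul1g mulVg.
by apply/ffunP => i; rewrite !ffE /= !invgK invg1 mul1g mulg1.
Qed.

Definition wreath_sub (G : set (sym T)) (K : {set 'S_m}) : set (wreath T m) :=
  [set w | (forall i, G (wbase w i)) /\ wtop w \in K].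

Definition prod_act (c : {ffun 'I_m -> T}) w : {ffun 'I_m -> T} :=
  [ffun i => wbase w ((wtop w)^-1 i) (c ((wtop w)^-1 i))].

Lemma prod_act1 c : prod_act c 1 = c.
Proof. by apply/ffunP => i; rewrite !ffE /= invg1 perm1. Qed.

Lemma prod_actM c w w' : prod_act c (w * w') = prod_act (prod_act c w) w'.
Proof.
by apply/ffunP => i; rewrite !ffE /= invMg !permM invgK permKV.
Qed.

Definition induced (X : set (wreath T m)) : {set 'S_m} :=
  [set h : 'S_m | `[< exists f, X (Wreath f h) >]]%SET.

Definition component (X : set (wreath T m)) (delta : 'I_m) : set (sym T) :=
  [set g | exists f h, [/\ X (Wreath f h), h delta = delta & g = f delta]].

Definition conj_set (X : set (wreath T m)) (x : wreath T m) :
    set (wreath T m) :=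
  [set y ^ x | y in X].

Definition code_image (C : set {ffun 'I_m -> T}) w : set {ffun 'I_m -> T} :=
  [set prod_act c w | c in C].

Definition code_aut (C : set {ffun 'I_m -> T}) : set (wreath T m) :=
  [set w | code_image C w = C].

Definition hamming (c c' : {ffun 'I_m -> T}) : nat :=
  #|[set i : 'I_m | `[< c i <> c' i >]]%SET|.

Definition min_distance (C : set {ffun 'I_m -> T}) (d : nat) : Prop :=
  (exists c c', [/\ C c, C c', c <> c' & hamming c c' = d]) /\
  (forall c c', C c -> C c' -> c <> c' -> (d <= hamming c c')%N).

End WreathProduct.

(* Main.v *)
Require Import Defs.
From mathcomp Require Import all_boot all_fingroup.
From mathcomp Require Import mathcomp_extra boolp classical_sets.

(** Choose codewords [c], [c'] at distance [d], and write [G] as the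
    [delta]-component of [X].  The conjugating element is [x = u s], with base
    part [u = (t_i^-1 g_i)_i] and top part [s], and each of the three
    ingredients achieves one of the conclusions.

    - By transitivity, each [i] has an element of [X] whose top part maps
      [delta] to [i]; let [t_i] be its entry at [delta].  For [f h] in [X], the
      permutation [t_i (i f) t_(i h)^-1] is the entry at [delta] of an element
      of [X] whose top part follows the route [delta -> i -> i h -> delta], so
      it lies in [G].  Thus conjugating by [(t_i^-1)_i] puts all the entries of
      all the elements of [X] into [G] (lemma [component_transport]).
    - As [G] is 2-transitive, some [g_i] in [G] maps the [i]-th entry of
      [c (t_i^-1)_i] to [gamma], and that of [c' (t_i^-1)_i] to [nu] when the
      two differ (lemma [two_transitive_move]).  Conjugation by [(g_i)_i]
      preserves [G wr H] because the [g_i] lie in the group [G].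
    - The permutation [s] brings the [d] positions where [c] and [c'] differ to
      the front (lemma [exists_sorting_perm]); it replaces [H] by [K = H^s].

    That [C^x] has automorphism group [X^x] is the usual conjugation of
    stabilisers (lemma [code_aut_image]). *)

Set Implicit Arguments.
Unset Strict Implicit.
Unset Printing Implicit Defensive.
Local Open Scope group_scope.
Local Open Scope classical_set_scope.

Definition subgroup (gT : groupType) (X : set gT) : Prop :=
  [/\ X 1, forall x y, X x -> X y -> X (x * y) & forall x, X x -> X x^-1].

(** * Coordinates in the wreath product *)

Section Coordinates.
Variables (T : Type) (m : nat).
Implicit Types (w : wreath T m) (u : {ffun 'I_m -> sym T}) (s : 'S_m).

Lemma wbaseM w w' i : wbase (w * w') i = wbase w i * wbase w' (wtop w i).
Proof. by rewrite ffunMgE ffunE invgK. Qed.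

Lemma wtopM w w' : wtop (w * w') = wtop w * wtop w'. Proof. by []. Qed.

Lemma wbaseV w i : wbase w^-1 i = (wbase w ((wtop w)^-1 i))^-1.
Proof. by rewrite ffunE ffunVgE. Qed.

Lemma wtopV w : wtop w^-1 = (wtop w)^-1. Proof. by []. Qed.

Lemma wreath_eta w : w = Wreath (wbase w) (wtop w). Proof. by case: w. Qed.

Lemma wbase_conj w u s i (j := s^-1 i) :
  wbase (w ^ Wreath u s) i = (u j)^-1 * (wbase w j * u (wtop w j)).
Proof. by rewrite /conjg !wbaseM wbaseV. Qed.

Lemma wtop_conj w u s : wtop (w ^ Wreath u s) = wtop w ^ s.
Proof. by []. Qed.

End Coordinates.

(** * Automorphism groups of codes *)

Section Codes.
Variables (T : Type) (m : nat).
Implicit Types (C : set {ffun 'I_m -> T}) (w x : wreath T m).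

Lemma code_image1 C : code_image C 1 = C.
Proof.
apply/seteqP; split=> [_ [c Cc <-]|c Cc]; first by rewrite prod_act1.
by exists c => //; rewrite prod_act1.
Qed.

Lemma code_imageM C w x :
  code_image C (w * x) = code_image (code_image C w) x.
Proof.
apply/seteqP; split=> [_ [c Cc <-]|_ [_ [c Cc <-] <-]].
  by exists (prod_act c w); [exists c | rewrite prod_actM].
by exists c => //; rewrite prod_actM.
Qed.

Lemma code_aut_subgroup C : subgroup (code_aut C).
Proof.
rewrite /code_aut; split=> [|x y Cx Cy|x Cx] /=; first exact: code_image1.
  by rewrite code_imageM Cx Cy.
by rewrite -{1}Cx -code_imageM mulgV code_image1.
Qed.

Lemma code_aut_image C x :
  code_aut (code_image C x) = conj_set (code_aut C) x.
Proof.
rewrite /code_aut /conj_set; apply/seteqP; split=> [w Cw | _ [y Cy <-]] /=.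
  exists (w ^ x^-1); last by rewrite conjgKV.
  by rewrite /= /conjg invgK !code_imageM Cw -code_imageM mulgV code_image1.
by rewrite -code_imageM -conjgC code_imageM Cy.
Qed.

End Codes.

(** * Induced group and components *)

Section Components.
Variables (T : Type) (m : nat) (X : set (wreath T m)).
Hypothesis gX : subgroup X.

Lemma mem_induced h : reflect (exists f, X (Wreath f h)) (h \in induced X).
Proof. by rewrite inE; apply: asboolP. Qed.

Lemma induced_top w : X w -> wtop w \in induced X.
Proof. by move=> Xw; apply/mem_induced; exists (wbase w); rewrite -wreath_eta. Qed.

Lemma induced_group_set : group_set (induced X).
Proof.
case: gX => X1 XM _; apply/group_setP; split; first exact: induced_top X1.
move=> h h' /mem_induced[f Xf] /mem_induced[f' Xf'].
exact: induced_top (XM _ _ Xf Xf').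
Qed.

Lemma component_entry delta w :
  X w -> wtop w delta = delta -> component X delta (wbase w delta).
Proof. by exists (wbase w), (wtop w); rewrite -wreath_eta. Qed.

Lemma component_subgroup delta : subgroup (component X delta).
Proof.
case: gX => X1 XM XV; split.
- by rewrite -(ffun1gE T delta); apply: (component_entry X1); apply: perm1.
- move=> _ _ [f [h [Xf hd ->]]] [f' [h' [Xf' hd' ->]]].
  have /= := @component_entry delta _ (XM _ _ Xf Xf').
  by rewrite ffunMgE ffunE invgK hd permM hd hd'; apply.
- move=> _ [f [h [Xf hd ->]]].
  have hVd : h^-1 delta = delta by rewrite -[in LHS]hd permK.
  have /= := @component_entry delta _ (XV _ Xf).
  by rewrite ffunE ffunVgE hVd; apply.
Qed.

(** [t i] is the entry at [delta] of an element of [X] taking [delta] to [i],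
    so that the displayed product is the entry at [delta] of an element of [X]
    fixing [delta]. *)
Lemma component_transport delta :
    [transitive induced X, on [set: 'I_m]%SET | 'P] ->
  exists t : 'I_m -> sym T, forall w i, X w ->
    component X delta (t i * wbase w i * (t (wtop w i))^-1).
Proof.
move=> trX; case: gX => _ XM XV.
have /choice[r rP] i : exists w, X w /\ wtop w delta = i.
  have := @atransP2 _ _ _ (Group induced_group_set) _ trX delta i.
  by case=> // h /mem_induced[f Xf] ->; exists (Wreath f h).
exists (fun i => wbase (r i) delta) => w i Xw.
have [Xi ri] := rP i; have [Xj rj] := rP (wtop w i).
have rjV : (wtop (r (wtop w i)))^-1 (wtop w i) = delta.
  by apply: (@perm_inj _ (wtop (r (wtop w i)))); rewrite permKV rj.
have := @component_entry delta _ (XM _ _ (XM _ _ Xi Xw) (XV _ Xj)).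
by rewrite !wbaseM wbaseV !wtopM wtopV !permM !ri rjV; apply.
Qed.

End Components.

(** * Moving entries and positions *)

Lemma two_transitive_move (T : Type) (G : set (sym T)) (p q a b : T) :
    two_transitive G -> p <> q ->
  exists g : sym T, [/\ G g, g a = p & a <> b -> g b = q].
Proof.
move=> G2 npq; have [<-|nab] := EM (a = b); last first.
  by have [g Gg [ga gb]] := G2 _ _ _ _ nab npq; exists g.
(* One of the two distinct points p, q differs from a and completes a pair. *)
have [e nae] : exists e, a <> e.
  have [->|nap] := EM (a = p); first by exists q.
  by exists p.
by have [g Gg [ga _]] := G2 _ _ _ _ nae npq; exists g.
Qed.

(** The permutation sends [i] to its rank in the list that enumerates [D]
    and then its complement. *)
Lemma exists_sorting_perm m (D : {set 'I_m}) :
  exists s : 'S_m, forall i, (s i < #|D|)%N = (i \in D).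
Proof.
pose e := enum D ++ enum (~: D)%SET.
have mem_e i : i \in e by rewrite mem_cat !mem_enum finset.in_setC orbN.
have size_e : size e = m by rewrite size_cat -!cardE cardsC card_ord.
have ltm i : (index i e < m)%N by rewrite -[X in (_ < X)%N]size_e index_mem.
have inj_s : injective (fun i => Ordinal (ltm i)).
  move=> i j [] eq_ij.
  by rewrite -(nth_index i (mem_e i)) eq_ij nth_index.
exists (perm inj_s) => i; rewrite permE /= cardE index_cat mem_enum.
have [iD | _] := ifPn; first by rewrite index_mem mem_enum.
by rewrite ltnNge leq_addr.
Qed.

Theorem theorem1p3 (m : nat) (m_gt0 : (0 < m)%N)
    (Gamma : Type) (gamma nu : Gamma) (gamma_neq_nu : gamma <> nu)
    (C : set {ffun 'I_m -> Gamma})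
    (C_gt1 : exists c c', [/\ C c, C c' & c <> c'])
    (d : nat) (C_dist : min_distance C d)
    (X : set (wreath Gamma m)) (X_aut : X = code_aut C)
    (H : {set 'S_m}) (H_ind : H = induced X)
    (H_trans : [transitive H, on [set: 'I_m]%SET | 'P])
    (G : set (sym Gamma)) (G_comp : exists delta, G = component X delta)
    (G_2trans : two_transitive G) :
  exists x : wreath Gamma m,
    [/\ code_aut (code_image C x) = conj_set X x,
        exists K : {group 'S_m},
          (exists s : 'S_m, K = H :^ s :> {set 'S_m}) /\
          conj_set X x `<=` wreath_sub G K,
        code_image C x [ffun _ => gamma] &
        code_image C x [ffun i : 'I_m => if (i < d)%N then nu else gamma]].
Proof.
have gX : subgroup X by rewrite X_aut; apply: code_aut_subgroup.
case: G_comp => delta defG.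
have [G1 GM GV] : subgroup G by rewrite defG; apply: component_subgroup.
have [t tP] : exists t : 'I_m -> sym Gamma, forall w i, X w ->
    G (t i * wbase w i * (t (wtop w i))^-1).
  by rewrite defG; apply: component_transport; rewrite -?H_ind.
have [[c [c' [Cc Cc' _ dist_cc']]] _] := C_dist.
have /choice[g gP] i : exists g : sym Gamma, [/\ G g,
    g ((t i)^-1 (c i)) = gamma &
    (t i)^-1 (c i) <> (t i)^-1 (c' i) -> g ((t i)^-1 (c' i)) = nu].
  exact: two_transitive_move.
have [s] := exists_sorting_perm [set i | `[< c i <> c' i >]]%SET.
rewrite -/(hamming c c') dist_cc' => sP.
pose u := [ffun i => (t i)^-1 * g i].
exists (Wreath u s); split; first by rewrite X_aut code_aut_image.
- have gHs : group_set (H :^ s).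
    by rewrite H_ind; apply: (valP (Group (induced_group_set gX) :^ s)%G).
  exists (Group gHs); split; first by exists s.
  move=> _ [w Xw <-]; split=> [i|]; last first.
    by rewrite wtop_conj memJ_conjg H_ind induced_top.
  rewrite wbase_conj; set j := s^-1 i; rewrite !ffunE.
  have [Gj _ _] := gP j; have [Gk _ _] := gP (wtop w j).
  (* The entry is g_j^-1 (t_j f_j t_k^-1) g_k, with k the image of j. *)
  have := GM _ _ (GV _ Gj) (GM _ _ (tP w j Xw) Gk).
  by rewrite invMg invgK !mulgA.
- exists c => //; apply/ffunP => i; rewrite !ffunE /=.
  by have [_] := gP (s^-1 i).
- exists c' => //; apply/ffunP => i; rewrite !ffunE /=.
  set j := s^-1 i; have <- : s j = i by rewrite permKV.
  rewrite sP inE; have [_ gc gc'] := gP j.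
  case: asboolP => [ncc' | /contrapT <- //]; apply: gc'.
  by move/(can_inj (@sym_invK _ (t j))).
Qed.
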